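(* Let $p,q>1$ with $\frac1p+\frac1q=1$, let $\mathbb{N}=N_1\cup N_2\cup\cdots$ be a partition of the set of positive integers into nonempty sets $N_1,N_2,\dots$, and put $\mathbf{N}_n:=N_1\cup\cdots\cup N_n$ for $n\ge 1$. Let $(a_n)_{n\ge1}$ be a sequence of complex numbers and let $(m_n)_{n\ge1}$ be a sequence of positive real numbers. Define, for $n\ge1$, $$w_n:=\Big(\sum_{j\in N_n} m_j^q\Big)^{1/q},\qquad M_n:=\sum_{j=1}^n w_j,$$ where all $w_n$ are finite, and $$\rho:=\sup_{n\ge1}\Big(w_n\sum_{j=n}^\infty \frac{1}{M_j}\Big)^{1/p}.$$ Assume that $\rho$ is finite. Then $$\Big(\sum_{n=1}^\infty\Big|\frac{1}{M_n}\sum_{j\in\mathbf{N}_n} m_j a_j\Big|^p\Big)^{1/p}\le \rho\,\Big(\sum_{n=1}^\infty |a_n|^p\Big)^{1/p}.$$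
   Context: $\mathbb{N}$ denotes the set of positive integers. A partition $\mathbb{N}=N_1\cup N_2\cup\cdots$ is an infinite sequence of pairwise disjoint nonempty sets with union $\mathbb{N}$ (so the sets $\mathbf{N}_n$ are strictly increasing and exhaust $\mathbb{N}$); the $N_n$ are not required to be intervals. The inequality is understood in $[0,+\infty]$, and is regarded as trivially true when the right-hand side is $+\infty$. *)

(* Defs.v *)
From HB Require Import structures.
From mathcomp Require Import all_boot all_order all_algebra.
From mathcomp Require Import complex.
From mathcomp Require Import all_classical all_reals all_analysis.

Set Implicit Arguments.
Unset Strict Implicit.
Unset Printing Implicit Defensive.

Import Order.TTheory GRing.Theory Num.Theory numFieldNormedType.Exports.
Local Open Scope classical_set_scope.
Local Open Scope complex_scope.
Local Open Scope ring_scope.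

Definition pos_nat : set nat := [set n | (0 < n)%N].

Section Defs.
Variable R : realType.
Implicit Types (p q : R) (N : nat -> set nat) (m : nat -> R) (a : nat -> R[i]).

(* All sequences are indexed from 1: their values at index 0 are never used. *)

Definition cum_block N (n : nat) : set nat :=
  \bigcup_(k in [set k | (0 < k <= n)%N]) N k.

Definition block_weight q N m (n : nat) : \bar R :=
  ((\esum_(j in N n) (m j `^ q)%:E) `^ q^-1)%E.

(* Meaningful when the weights of the blocks are finite, since [fine] sends
   [+oo] to 0. *)
Definition cum_weight q N m (n : nat) : R :=
  \sum_(1 <= j < n.+1) fine (block_weight q N m j).

Definition rho p q N m : \bar R :=
  ereal_sup [set ((block_weight q N m n *
                   \sum_(n <= j <oo) ((cum_weight q N m j)^-1)%:E) `^ p^-1)%E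
            | n in pos_nat].

(* A possibly infinite set is summed in increasing order of the indices. The
   annotation [^o] selects the topology of [R[i]] given by the modulus. *)
Definition cum_sum N m a (n : nat) : R[i] :=
  limn (fun k : nat =>
    \sum_(1 <= j < k | j \in cum_block N n) ((m j)%:C * a j) : R[i]^o).

(* The norm of [R[i]] takes its values in [R[i]]; this is its real version. *)
Definition cmod (z : R[i]) : R := complex.Re `|z|.

Definition lp_norm p a : \bar R :=
  ((\sum_(1 <= n <oo) (cmod (a n) `^ p)%:E) `^ p^-1)%E.

Definition weighted_mean q N m a (n : nat) : R[i] :=
  ((cum_weight q N m n)^-1)%:C * cum_sum N m a n.

End Defs.

(* Main.v *)
Require Import Defs.
From mathcomp Require Import all_boot all_order all_algebra.
From mathcomp Require Import complex.
From mathcomp Require Import all_classical all_reals all_analysis.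
Import Order.TTheory GRing.Theory Num.Theory numFieldNormedType.Exports.
Local Open Scope classical_set_scope.
Local Open Scope ring_scope.

(** Write [w], [M] for the block weights and their partial sums, and [k(i)] for
the index of the block that contains [i]. The proof is the weighted Hardy
inequality argument, with one application of Hoelder's inequality per mean.

Splitting each term as
  [m_i |a_i| = (m_i w_k(i)^(-1/p)) * (w_k(i)^(1/p) |a_i|)]
and summing over the first [n] blocks, Hoelder gives
  [sum m_i |a_i| <= M_n^(1/q) (sum w_k(i) |a_i|^p)^(1/p)],
because the [q]-th powers of the first factors add up, over block [k], to
[w_k^q w_k^(-q/p) = w_k], hence to [M_n] in total ([block_hoelder]). Divided by
[M_n] and raised to the power [p], this reads
  [|mean_n|^p <= M_n^-1 sum_(k(i) <= n) w_k(i) |a_i|^p]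
([weighted_mean_bound]). It remains to sum over [n] and to exchange the two
nonnegative sums ([nneseries_exchange_tail]): the coefficient of [|a_i|^p]
becomes [w_k(i) sum_(n >= k(i)) M_n^-1], which is at most [rho^p] by the
definition of [rho]. *)

(** * The modulus of complex numbers *)

Lemma cmodE {R : realType} (z : R[i]) : `|z| = (cmod z)%:C%C.
Proof. by rewrite /cmod RRe_real ?normr_real. Qed.

Lemma cmod_ge0 {R : realType} (z : R[i]) : 0 <= cmod z.
Proof. by rewrite -lecR -cmodE; exact: normr_ge0. Qed.

Lemma cmodM {R : realType} (y z : R[i]) : cmod (y * z) = cmod y * cmod z.
Proof. by apply: complexI; rewrite rmorphM /= -!cmodE normrM. Qed.

Lemma cmod_real {R : realType} (x : R) : 0 <= x -> cmod x%:C%C = x.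
Proof. by move=> x0; apply: complexI; rewrite -cmodE ger0_norm // ler0c. Qed.

Lemma ler_cmodD {R : realType} (y z : R[i]) : cmod (y + z) <= cmod y + cmod z.
Proof. by rewrite -lecR rmorphD /= -!cmodE ler_normD. Qed.

Lemma ler_cmod_sum {R : realType} (I : Type) (s : seq I) (P : pred I)
    (f : I -> R[i]) :
  cmod (\sum_(i <- s | P i) f i) <= \sum_(i <- s | P i) cmod (f i).
Proof.
apply: (big_ind2 (fun z x => cmod z <= x)) => // [|y x z t yx zt].
  by rewrite /cmod normr0.
exact: le_trans (ler_cmodD _ _) (lerD yx zt).
Qed.

(** The closed disc of radius [B] contains the limit of a sequence of its points,
and also the default limit 0 of a divergent one. *)
Lemma cmod_lim_le {R : realType} (u : nat -> R[i]) (B : R) :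
  (forall n, cmod (u n) <= B) -> cmod (limn (u : nat -> R[i]^o)) <= B.
Proof.
move=> uB; have [cvu|dvu] := pselect (cvgn (u : nat -> R[i]^o)); last first.
  rewrite dvgP //; apply: le_trans (uB 0%N).
  have -> : cmod (point : R[i]^o) = 0 by rewrite /cmod normr0.
  exact: cmod_ge0.
set l := limn _; rewrite leNgt; apply/negP => Bl.
have e0 : 0 < (cmod l - B)%:C%C :> R[i] by rewrite ltcR subr_gt0.
have [n _ /(_ n (leqnn n)) /=] := cvgr_dist_lt (u : nat -> R[i]^o) l cvu _ e0.
rewrite cmodE ltcR ltNge lerBlDr => /negP; apply.
rewrite -{1}(subrK (u n) l); apply: le_trans (ler_cmodD _ _) _.
by rewrite lerD2l.
Qed.

(** * Hoelder's inequality over blocks *)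

(** The two-term inequality iterated: the powers of the partial norms
telescope, since [(X^(1/p))^p = X]. *)
Lemma hoelder_sum {R : realType} (I : Type) (s : seq I) (P : pred I)
    (f g : I -> R) (p q : R) :
  0 < p -> 0 < q -> p^-1 + q^-1 = 1 ->
  (forall i, P i -> 0 <= f i) -> (forall i, P i -> 0 <= g i) ->
  \sum_(i <- s | P i) f i * g i <=
  (\sum_(i <- s | P i) f i `^ p) `^ p^-1 *
  (\sum_(i <- s | P i) g i `^ q) `^ q^-1.
Proof.
move=> p0 q0 pq f0 g0; elim: s => [|i s IH].
  by rewrite !big_nil !powR0 ?mulr0 // invr_eq0 gt_eqF.
rewrite !big_cons; case: ifPn => // Pi.
have sum_ge0 (h : I -> R) (r : R) : 0 <= \sum_(j <- s | P j) h j `^ r.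
  by apply: sumr_ge0 => j _; exact: powR_ge0.
have powK (r y : R) : 0 < r -> 0 <= y -> (y `^ r^-1) `^ r = y.
  by move=> r0 y0; rewrite -powRrM mulVf ?powRr1 // gt_eqF.
apply: le_trans (lerD (lexx _) IH) _.
rewrite -{2}(powK p (\sum_(j <- s | P j) f j `^ p)) //.
rewrite -{2}(powK q (\sum_(j <- s | P j) g j `^ q)) //.
by apply: hoelder2; rewrite ?powR_ge0 ?f0 ?g0.
Qed.

Lemma sum_blocks {R : realType} (blk : nat -> nat) (f : nat -> R) (n K : nat) :
  (forall i, (0 < i)%N -> (0 < blk i)%N) ->
  \sum_(1 <= i < K | (blk i <= n)%N) f i =
  \sum_(1 <= k < n.+1) \sum_(1 <= i < K | blk i == k) f i.
Proof.
move=> blk0; under [RHS]eq_bigr do rewrite big_mkcond /=.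
rewrite exchange_big /= big_mkcond /=; apply: eq_big_nat => i /andP[i0 _].
rewrite -big_mkcond /=; under eq_bigl do rewrite eq_sym.
by rewrite big_nat1_eq ltnS blk0.
Qed.

(** The sums stop at [K] because a block may be infinite. The factor coming from
[m] is bounded by [M_n^(1/q)] whatever [K] is, which lets [K] tend to infinity
later. *)
Lemma block_hoelder {R : realType} (p q : R) (w : nat -> R) (blk : nat -> nat)
    (m x : nat -> R) (n K : nat) :
  0 < p -> 0 < q -> p^-1 + q^-1 = 1 ->
  (forall i, (0 < i)%N -> (0 < blk i)%N) ->
  (forall k, (0 < k)%N -> 0 < w k) ->
  (forall i, (0 < i)%N -> 0 <= m i) -> (forall i, 0 <= x i) ->
  (forall k, (0 < k)%N -> \sum_(1 <= i < K | blk i == k) m i `^ q <= w k `^ q) ->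
  \sum_(1 <= i < K | (blk i <= n)%N) m i * x i <=
  (\sum_(1 <= k < n.+1) w k) `^ q^-1 *
  (\sum_(1 <= i < K | (blk i <= n)%N) w (blk i) * x i `^ p) `^ p^-1.
Proof.
move=> p0 q0 pq blk0 w0 m0 x0 mw.
(* The power of [w] moved from one factor to the other is the one for which the
   [q]-th powers of the first factors sum to at most [w k] over block [k]. *)
have -> : \sum_(1 <= i < K | (blk i <= n)%N) m i * x i =
    \sum_(1 <= i < K | (blk i <= n)%N)
      (m i * w (blk i) `^ - p^-1) * (w (blk i) `^ p^-1 * x i).
  rewrite big_nat_cond [RHS]big_nat_cond; apply: eq_bigr => i /andP[/andP[i0 _] _].
  rewrite powRN mulrA mulfVK // gt_eqF // powR_gt0 //; exact: w0 (blk0 _ i0).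
rewrite big_nat_cond; apply: le_trans (hoelder_sum _ _ _ _ _ _ _ q0 p0 _ _ _) _.
- by rewrite addrC.
- by move=> i /andP[/andP[i0 _] _]; rewrite mulr_ge0 ?powR_ge0 ?m0.
- by move=> i _; rewrite mulr_ge0 ?powR_ge0.
rewrite -!big_nat_cond; apply: ler_pM; rewrite ?powR_ge0 //; last first.
  rewrite le_eqVlt; apply/orP; left; apply/eqP; congr (_ `^ _).
  rewrite big_nat_cond [RHS]big_nat_cond; apply: eq_bigr => i /andP[/andP[i0 _] _].
  by rewrite powRM ?powR_ge0 // -powRrM mulVf ?powRr1 // ?gt_eqF // ltW // w0 // blk0.
have sum_ge0 (h : nat -> R) a b P : (forall i, (a <= i)%N -> 0 <= h i) ->
    0 <= \sum_(a <= i < b | P i) h i.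
  move=> h0; rewrite big_nat_cond; apply: sumr_ge0 => i /andP[/andP[ai _] _].
  exact: h0.
apply: ge0_ler_powR; rewrite ?nnegrE ?invr_ge0 ?(ltW q0) //.
- by apply: sum_ge0 => i _; exact: powR_ge0.
- by apply: sum_ge0 => i i0; rewrite ltW // w0.
rewrite sum_blocks //; apply: ler_sum_nat => k /andP[k0 _].
have -> : \sum_(1 <= i < K | blk i == k) (m i * w (blk i) `^ - p^-1) `^ q =
    \sum_(1 <= i < K | blk i == k) m i `^ q * (w k `^ - p^-1) `^ q.
  rewrite big_nat_cond [RHS]big_nat_cond.
  apply: eq_bigr => i /andP[/andP[i0 _] /eqP ->].
  by rewrite powRM ?powR_ge0 ?m0.
rewrite -mulr_suml -powRrM.
apply: le_trans (ler_wpM2r (powR_ge0 _ _) (mw k k0)) _.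
have wk0 := w0 k k0.
rewrite -powRD ?(gt_eqF wk0) ?implybT //.
(* The exponents satisfy [q - q / p = q (1 - 1 / p) = 1]. *)
have -> : q + - p^-1 * q = 1.
  by rewrite -{1}(mul1r q) -mulrDl -pq addrAC subrr add0r mulVf // gt_eqF.
by rewrite powRr1 // ltW.
Qed.

(** * Exchange of summations *)

(** Tonelli's theorem on the region [blk i <= n]: for fixed [i] it is the tail
[n >= blk i], which lies in the range [n >= 1] because blocks are numbered
from 1. *)
Lemma nneseries_exchange_tail {R : realType} (blk : nat -> nat) (b c : nat -> R) :
  (forall i, (0 < i)%N -> (0 < blk i)%N) ->
  (forall i, 0 <= b i) -> (forall n, 0 <= c n) ->
  (\sum_(1 <= n <oo) (c n)%:E * \sum_(1 <= i <oo | (blk i <= n)%N) (b i)%:E =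
   \sum_(1 <= i <oo) (b i)%:E * \sum_(blk i <= n <oo) (c n)%:E)%E.
Proof.
move=> blk0 b0 c0; rewrite eseries_cond [RHS]eseries_cond /=.
pose F n i : \bar R := ((c n)%:E * if (blk i <= n)%N then (b i)%:E else 0)%E.
have if_ge0 i n : (0 <= if (blk i <= n)%N then (b i)%:E else 0)%E.
  by case: ifP => _; rewrite ?lee_fin.
transitivity (\sum_(n <oo | (0 < n)%N) \sum_(i <oo | (0 < i)%N) F n i)%E.
  apply: eq_eseriesr => n _; rewrite nneseriesZl => [|i _]; last exact: if_ge0.
  by rewrite eseries_cond eseries_mkcondl.
rewrite nneseries_interchange; last by move=> n i; rewrite mule_ge0 ?lee_fin.
apply: eq_eseriesr => i i0; rewrite -nneseriesZl => [|n _]; last by rewrite lee_fin.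
rewrite [RHS]eseries_cond /= eseries_mkcond [RHS]eseries_mkcond.
apply: eq_eseriesr => n _; rewrite /F muleC.
case: (leqP (blk i) n) => [bn|_]; last by rewrite mul0e; case: ifP.
by rewrite (leq_trans (blk0 _ i0) bn).
Qed.

(** * Block weights *)

Lemma partition_index {N : nat -> set nat} : partition pos_nat N pos_nat ->
  exists blk : nat -> nat, (forall i, (0 < i)%N -> (0 < blk i)%N) /\
    (forall i k, (0 < i)%N -> (0 < k)%N -> N k i <-> blk i = k).
Proof.
move=> [cov triv _].
have : forall i, exists k, (0 < i)%N -> (0 < k)%N /\ N k i.
  move=> i; have [i0|] := ltnP 0 i; last by exists 0%N.
  have : pos_nat i by [].
  by rewrite -cov => -[k k0 Nki]; exists k.
move=> /choice[blk blkP]; exists blk; split=> [i /blkP[] //|i k i0 k0].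
have [b0 Nb] := blkP _ i0; split=> [Nk|<- //].
by apply: triv => //; exists i.
Qed.

Lemma fine_block_weight_ge0 {R : realType} (q : R) (N : nat -> set nat) (m : nat -> R)
    (k : nat) : 0 <= fine (block_weight q N m k).
Proof. by apply: fine_ge0; exact: poweR_ge0. Qed.

Lemma cum_weight_ge0 {R : realType} (q : R) (N : nat -> set nat) (m : nat -> R)
    (n : nat) : 0 <= cum_weight q N m n.
Proof. by apply: sumr_ge0 => k _; exact: fine_block_weight_ge0. Qed.

(** An infinite weight would be read as 0 by [fine]; a finite one forces the sum
under the [1/q]-th power to be finite, so its real value dominates every
finite partial sum. *)
Lemma sum_le_block_weight {R : realType} (q : R) (N : nat -> set nat) (m : nat -> R)
    (s : seq nat) (P : pred nat) (k : nat) :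
  0 < q -> uniq s ->
  block_weight q N m k \is a fin_num ->
  (forall i, i \in s -> P i -> N k i) ->
  \sum_(i <- s | P i) m i `^ q <= fine (block_weight q N m k) `^ q.
Proof.
move=> q0 us wfin sN; set S : \bar R := (\esum_(i in N k) (m i `^ q)%:E)%E.
have S0 : (0 <= S)%E by apply: esum_ge0 => i _; rewrite lee_fin powR_ge0.
have Sfin : S \is a fin_num.
  move: wfin S0; rewrite /block_weight -/S.
  by case: S => //=; rewrite gt_eqF ?invr_gt0.
rewrite /block_weight -/S fine_poweR -powRrM mulVf ?gt_eqF // powRr1 ?fine_ge0 //.
rewrite -lee_fin fineK // -sumEFin -big_filter.
rewrite fsbig_seq ?filter_uniq //; apply: esum_ge.
exists [set` [seq i <- s | P i]] => //; split=> [|i /=]; first exact: finite_seq.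
by rewrite mem_filter => /andP[Pi si]; exact: sN.
Qed.

Lemma block_weight_gt0 {R : realType} (q : R) (N : nat -> set nat) (m : nat -> R)
    (k : nat) :
  0 < q -> N k !=set0 -> (forall i, N k i -> 0 < m i) ->
  block_weight q N m k \is a fin_num -> 0 < fine (block_weight q N m k).
Proof.
move=> q0 [i Ni] m0 wfin; rewrite lt0r fine_block_weight_ge0 andbT.
apply/eqP => wk0.
have := @sum_le_block_weight _ q N m [:: i] predT k q0 erefl wfin.
rewrite big_seq1 wk0 powR0 ?gt_eqF // leNgt powR_gt0 ?m0 //= => le0.
by apply/notF/le0 => j; rewrite inE => /eqP ->.
Qed.

(** * The inequality *)

(** The pointwise estimate behind the theorem: Hoelder's inequality bounds the
partial sums of [cum_sum] uniformly by [M^(1/q) B^(1/p)], where [B] is the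
series on the right, and [(M^-1 M^(1/q))^p = M^-1]. *)
Lemma weighted_mean_bound {R : realType} (p q : R) (N : nat -> set nat)
    (blk : nat -> nat) (a : nat -> R[i]) (m : nat -> R) (n : nat)
    (w := fun k => fine (block_weight q N m k)) :
  0 < p -> 0 < q -> p^-1 + q^-1 = 1 ->
  (forall i, (0 < i)%N -> (0 < blk i)%N) ->
  (forall i k, (0 < i)%N -> (0 < k)%N -> N k i <-> blk i = k) ->
  (forall i, (0 < i)%N -> 0 < m i) ->
  (forall k, (0 < k)%N -> block_weight q N m k \is a fin_num) ->
  (forall k, (0 < k)%N -> 0 < w k) -> (0 < n)%N ->
  ((cmod (weighted_mean q N m a n) `^ p)%:E <=
   ((cum_weight q N m n)^-1)%:E *
   \sum_(1 <= i <oo | (blk i <= n)%N) (w (blk i) * cmod (a i) `^ p)%:E)%E.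
Proof.
move=> p0 q0 pq blk0 blkP m0 wfin w0 n0.
set M := cum_weight q N m n.
have M0 : 0 < M.
  rewrite /M /cum_weight big_nat_recl //; apply: ltr_pwDl; first exact: w0.
  by apply: sumr_ge0 => k _; exact: fine_block_weight_ge0.
have MV0 : 0 <= M^-1 by rewrite invr_ge0 ltW.
have term_ge0 i : (0 <= (w (blk i) * cmod (a i) `^ p)%:E)%E.
  by rewrite lee_fin mulr_ge0 ?powR_ge0 ?fine_block_weight_ge0.
set B : \bar R := (\sum_(1 <= i <oo | _) _)%E.
have B0 : (0 <= B)%E by apply: nneseries_ge0 => i _ _.
have [Bfin|] := boolP (B \is a fin_num); last first.
  rewrite ge0_fin_numE // -leNgt leye_eq => /eqP ->.
  by rewrite gt0_muley ?leey // lte_fin invr_gt0.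
have sum_bound K :
    cmod (\sum_(1 <= j < K | j \in cum_block N n) ((m j)%:C%C * a j)) <=
    M `^ q^-1 * fine B `^ p^-1.
  have -> : \sum_(1 <= j < K | j \in cum_block N n) ((m j)%:C%C * a j) =
      \sum_(1 <= j < K | (blk j <= n)%N) ((m j)%:C%C * a j).
    rewrite big_nat_cond [RHS]big_nat_cond; apply: eq_bigl => j.
    case: (ltnP 0 j) => //= j0; congr andb.
    apply/idP/idP => [|bn].
      by rewrite inE => -[k /= /andP[k0 kn]] /(blkP _ _ j0 k0) ->.
    by rewrite inE; exists (blk j) => /=; [rewrite blk0|apply/blkP => //; exact: blk0].
  apply: le_trans (ler_cmod_sum _ _ _ _) _.
  have -> : \sum_(1 <= j < K | (blk j <= n)%N) cmod ((m j)%:C%C * a j) =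
      \sum_(1 <= j < K | (blk j <= n)%N) m j * cmod (a j).
    rewrite big_nat_cond [RHS]big_nat_cond; apply: eq_bigr => j /andP[/andP[j0 _] _].
    by rewrite cmodM cmod_real // ltW // m0.
  apply: le_trans (@block_hoelder _ p q w blk _ _ _ _ p0 q0 pq blk0 w0 _ _ _) _.
  - by move=> i i0; exact/ltW/m0.
  - by move=> i; exact: cmod_ge0.
  - move=> k k0; apply: sum_le_block_weight => //.
    + exact: iota_uniq.
    + exact: wfin.
    + move=> i; rewrite mem_iota => /andP[i0 _] /eqP ik.
      exact/blkP.
  rewrite ler_wpM2l ?powR_ge0 //; apply: ge0_ler_powR.
  - by rewrite invr_ge0 ltW.
  - rewrite nnegrE; apply: sumr_ge0 => i _; exact: term_ge0.
  - by rewrite nnegrE fine_ge0.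
  rewrite -lee_fin fineK // -sumEFin.
  by apply: nneseries_lim_ge => i _ _.
have powK (y : R) : 0 <= y -> (y `^ p^-1) `^ p = y.
  by move=> y0; rewrite -powRrM mulVf ?powRr1 // gt_eqF.
rewrite -(fineK Bfin) -EFinM lee_fin /weighted_mean cmodM cmod_real //.
have := cmod_lim_le _ _ sum_bound; rewrite -/(cum_sum N m a n) => cs.
apply: le_trans (_ : (M^-1 * (M `^ q^-1 * fine B `^ p^-1)) `^ p <= _).
  apply: ge0_ler_powR; first exact: ltW.
  - by rewrite nnegrE mulr_ge0 ?cmod_ge0.
  - by rewrite nnegrE !mulr_ge0 ?powR_ge0.
  - by rewrite ler_pM2l ?invr_gt0.
have -> : M^-1 * (M `^ q^-1 * fine B `^ p^-1) = (M^-1) `^ p^-1 * fine B `^ p^-1.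
  rewrite mulrA; congr (_ * _).
  rewrite -powR_inv1 ?ltW // -powRD ?(gt_eqF M0) ?implybT // -powRrM mulN1r.
  by congr (_ `^ _); rewrite -pq opprD subrK.
by rewrite powRM ?powR_ge0 // !powK ?fine_ge0.
Qed.

Theorem theorem1 (R : realType) (p q : R) (N : nat -> set nat)
    (a : nat -> R[i]) (m : nat -> R)
    (p_gt1 : 1 < p) (q_gt1 : 1 < q) (pq : p^-1 + q^-1 = 1)
    (N_part : partition pos_nat N pos_nat)
    (m_gt0 : forall n : nat, (0 < n)%N -> 0 < m n)
    (w_fin : forall n : nat, (0 < n)%N -> block_weight q N m n \is a fin_num)
    (rho_fin : rho p q N m \is a fin_num) :
  (lp_norm p (weighted_mean q N m a) <= rho p q N m * lp_norm p a)%E.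
Proof.
have p0 : 0 < p by apply: lt_trans p_gt1.
have q0 : 0 < q by apply: lt_trans q_gt1.
have [cov _ Nn0] := N_part.
have [blk [blk0 blkP]] := partition_index N_part.
pose w k := fine (block_weight q N m k).
pose M := cum_weight q N m.
have wE k : (0 < k)%N -> block_weight q N m k = (w k)%:E.
  by move=> k0; rewrite /w fineK // w_fin.
have w_gt0 k : (0 < k)%N -> 0 < w k.
  move=> k0; apply: block_weight_gt0 => //; [exact: Nn0| |exact: w_fin].
  move=> i Ni; apply: m_gt0; have : pos_nat i by rewrite -cov; exists k.
  by [].
set r := fine (rho p q N m).
have rE : rho p q N m = r%:E by rewrite /r fineK.
have tail_bound k : (0 < k)%N ->
    ((w k)%:E * \sum_(k <= j <oo) ((M j)^-1)%:E <= (r `^ p)%:E)%E.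
  move=> k0; set X := (X in (X <= _)%E).
  have X0 : (0 <= X)%E.
    rewrite mule_ge0 ?lee_fin ?fine_block_weight_ge0 //.
    by apply: nneseries_ge0 => j _ _; rewrite lee_fin invr_ge0 cum_weight_ge0.
  have Xr : (X `^ p^-1 <= r%:E)%E.
    by rewrite -rE; apply: ereal_sup_ubound; exists k => //; rewrite wE.
  rewrite -poweR_EFin -(poweRe1 X0) -(mulVf (lt0r_neq0 p0)) poweRrM.
  apply: gt0_ler_poweR => //; first exact: ltW.
  - by rewrite in_itv /= poweR_ge0 leey.
  - by rewrite in_itv /= leey andbT; apply: le_trans Xr; exact: poweR_ge0.
have r0 : 0 <= r.
  rewrite -lee_fin -rE; apply: (@le_trans _ _ ((block_weight q N m 1 *
    \sum_(1 <= j <oo) ((cum_weight q N m j)^-1)%:E) `^ p^-1)%E).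
    exact: poweR_ge0.
  by apply: ereal_sup_ubound; exists 1%N.
have main : (\sum_(1 <= n <oo) (cmod (weighted_mean q N m a n) `^ p)%:E <=
    (r `^ p)%:E * \sum_(1 <= i <oo) (cmod (a i) `^ p)%:E)%E.
  pose b i := w (blk i) * cmod (a i) `^ p.
  apply: (@le_trans _ _ (\sum_(1 <= n <oo)
      ((M n)^-1)%:E * \sum_(1 <= i <oo | (blk i <= n)%N) (b i)%:E)%E).
    rewrite eseries_cond [leRHS]eseries_cond; apply: lee_nneseries.
      by move=> n _ _; rewrite lee_fin powR_ge0.
    by move=> n n0; exact: weighted_mean_bound.
  rewrite nneseries_exchange_tail //; last 2 first.
  - by move=> i; rewrite mulr_ge0 ?powR_ge0 ?fine_block_weight_ge0.
  - by move=> n; rewrite invr_ge0 cum_weight_ge0.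
  rewrite -nneseriesZl => [|i _]; last by rewrite lee_fin powR_ge0.
  rewrite eseries_cond [leRHS]eseries_cond; apply: lee_nneseries => i.
    move=> _ _; rewrite mule_ge0 //.
      by rewrite lee_fin mulr_ge0 ?powR_ge0 ?fine_block_weight_ge0.
    by apply: nneseries_ge0 => j _ _; rewrite lee_fin invr_ge0 cum_weight_ge0.
  move=> /= i0; rewrite /b mulrC EFinM -muleA [leRHS]muleC.
  by rewrite lee_wpmul2l ?lee_fin ?powR_ge0 // tail_bound // blk0.
rewrite rE /lp_norm.
have S0 u : (0 <= \sum_(1 <= i <oo) (cmod (u i : R[i]) `^ p)%:E)%E.
  by apply: nneseries_ge0 => i _ _; rewrite lee_fin powR_ge0.
apply: (@le_trans _ _ (((r `^ p)%:E *
    \sum_(1 <= i <oo) (cmod (a i) `^ p)%:E) `^ p^-1)%E).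
  apply: gt0_ler_poweR => //; first by rewrite invr_ge0 ltW.
  - by rewrite in_itv /= S0 leey.
  - by rewrite in_itv /= leey andbT mule_ge0 ?lee_fin ?powR_ge0.
rewrite poweRM ?lee_fin ?powR_ge0 //.
by rewrite poweR_EFin -powRrM mulfV ?gt_eqF // powRr1.
Qed.
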